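(* Let $A$ be a finite-dimensional algebra over a field $k$, let $\Sigma$ be a finite-dimensional $A$-bimodule, and write $\Sigma(-)=\Sigma\otimes_A(-)$ for the associated endofunctor of $A\text{-mod}$. Let $\lambda\in\mathrm{HH}_0(\Sigma)^*=\{\lambda\in\Sigma^*\mid\lambda(sa)=\lambda(as)\ \text{for all}\ s\in\Sigma,\ a\in A\}$, and let $\mathtt{t}^\lambda_\bullet$ be the $\Sigma$-twisted trace on $A\text{-proj}$ corresponding to $\lambda$, i.e. $\mathtt{t}^\lambda_P=\lambda\circ\mathtt{T}_P$. Define $$\beta^\lambda_{M,P}:\mathrm{Hom}_A(M,\Sigma(P))\times\mathrm{Hom}_A(P,M)\to k,\quad(f,g)\mapsto\mathtt{t}^\lambda_P(fg)$$ for $M\in A\text{-mod}$ and $P\in A\text{-proj}$. Then the following are equivalent: (1) The $\Sigma$-twisted trace $\mathtt{t}^\lambda_\bullet$ on $A\text{-proj}$ is non-degenerate. (2) The pairing $\beta^\lambda_{P,Q}$ is non-degenerate for all $P,Q\in A\text{-proj}$. (3) The map $\lambda^\natural:\Sigma\to A^*$, $\langle\lambda^\natural(s),a\rangle=\lambda(as)$, is an isomorphism. Thus, in particular, a non-degenerate $\Sigma$-twisted trace on $A\text{-proj}$ exists only if $\Sigma$ is isomorphic to $A^*$ as an $A$-bimodule.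
   Context: $A\text{-mod}$ is the category of finite-dimensional left $A$-modules and $A\text{-proj}$ its full subcategory of projective objects. $A^*=\mathrm{Hom}_k(A,k)$ is an $A$-bimodule by $\langle a\rightharpoonup f,b\rangle=f(ba)$ and $\langle f\leftharpoonup a,b\rangle=f(ab)$. A $\Sigma$-twisted trace on $A\text{-proj}$ is a family of $k$-linear maps $\mathtt{t}_P:\mathrm{Hom}_A(P,\Sigma(P))\to k$ ($P\in A\text{-proj}$) such that $\mathtt{t}_P(g\circ f)=\mathtt{t}_Q(\Sigma(f)\circ g)$ for all $P,Q\in A\text{-proj}$, $f:P\to Q$, $g:Q\to\Sigma(P)$. It is non-degenerate if the pairing $\mathrm{Hom}_A(M,\Sigma(P))\times\mathrm{Hom}_A(P,M)\to k$, $(f,g)\mapsto\mathtt{t}_P(fg)$, is non-degenerate for all $M\in A\text{-mod}$ and $P\in A\text{-proj}$. $\mathrm{HH}_0(\Sigma)=\Sigma/\mathrm{span}_k\{as-sa\mid a\in A,\ s\in\Sigma\}$, with $[s]$ the class of $s$; linear forms on $\mathrm{HH}_0(\Sigma)$ are identified with elements $\lambda\in\Sigma^*$ satisfying $\lambda(sa)=\lambda(as)$. For $P\in A\text{-proj}$ put $P^\dagger=\mathrm{Hom}_A(P,A)$, a right $A$-module by $(p^\dagger\cdot a)(p)=p^\dagger(p)a$. The map $\theta_{P,M}:P^\dagger\otimes_AM\to\mathrm{Hom}_A(P,M)$, $\theta_{P,M}(p^\dagger\otimes m)(p)=p^\dagger(p)m$, is bijective. The universal twisted trace $\mathtt{T}_P:\mathrm{Hom}_A(P,\Sigma(P))\to\mathrm{HH}_0(\Sigma)$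 is $\theta_{P,\Sigma(P)}^{-1}$ followed by $P^\dagger\otimes_A\Sigma\otimes_AP\to\mathrm{HH}_0(\Sigma)$, $p^\dagger\otimes s\otimes p\mapsto[p^\dagger(p)s]$. The assignment $\lambda\mapsto\lambda\circ\mathtt{T}_\bullet$ is a bijection from $\mathrm{HH}_0(\Sigma)^*$ to the set of $\Sigma$-twisted traces on $A\text{-proj}$. *)

(* Defs.v *)
From HB Require Import structures.
From mathcomp Require Import all_boot ssralg matrix vector falgebra.

Set Implicit Arguments.
Unset Strict Implicit.
Unset Printing Implicit Defensive.

Import GRing.Theory.
Local Open Scope ring_scope.

Section LinearAlgebra.

Variable k : fieldType.

Definition bilin (U V W : lmodType k) (b : U -> V -> W) : Prop :=
  (forall v, linear (fun u => b u v)) /\ (forall u, linear (b u)).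

Definition nondegenerate_pairing (U V : lmodType k) (b : U -> V -> k) : Prop :=
  (forall u, (forall v, b u v = 0) -> u = 0) /\
  (forall v, (forall u, b u v = 0) -> v = 0).

Lemma linfunE (U V : vectType k) (f : U -> V) : linear f -> linfun f =1 f.
Proof.
move=> lf; pose F := GRing.isLinear.Build k U V *:%R f lf.
pose ff : {linear U -> V} := HB.pack f F.
exact: (lfunE ff).
Qed.

(* The quotient V / U, realized on the complement U^C of U; vpi_eq0 and
   vpi_surj identify vpi with the canonical projection. *)
Section Quotient.

Variables (V : vectType k) (U : {vspace V}).

Definition vquot : vectType k := subvs_of (U^C)%VS.

Fact vpi_subproof (v : V) : v - projv U v \in (U^C)%VS.
Proof. exact: memv_projC. Qed.

Definition vpi (v : V) : vquot := Subvs (vpi_subproof v).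

Lemma vpi_linear : linear vpi.
Proof.
move=> c u v; apply: val_inj => /=.
by rewrite linearP scalerBr opprD addrACA.
Qed.

HB.instance Definition _ := GRing.isLinear.Build k V vquot *:%R vpi vpi_linear.

Lemma vpi_eq0 v : (vpi v == 0) = (v \in U).
Proof.
apply/eqP/idP => [/(congr1 val) /= /eqP | vU].
  by rewrite subr_eq0 => /eqP->; apply: memv_proj.
by apply: val_inj; rewrite /= projv_id // subrr.
Qed.

Lemma vpiK (q : vquot) : vpi (vsval q) = q.
Proof.
apply: val_inj => /=; rewrite -[RHS]subr0; congr (_ - _); apply/eqP.
by rewrite -memv_ker lker_proj subvsP.
Qed.

Lemma vpi_surj (q : vquot) : exists v, vpi v = q.
Proof. by exists (vsval q); apply: vpiK. Qed.

(* Meaningful only for f vanishing on U; see vliftE. *)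
Definition vlift (W : vectType k) (f : 'Hom(V, W)) : 'Hom(vquot, W) :=
  linfun (fun q : vquot => f (vsval q)).

Lemma vliftK (W : vectType k) (f : 'Hom(V, W)) q : vlift f q = f (vsval q).
Proof. by rewrite linfunE // => c u v; rewrite linearP. Qed.

Lemma vliftE (W : vectType k) (f : 'Hom(V, W)) v :
  (U <= lker f)%VS -> vlift f (vpi v) = f v.
Proof.
move=> Uf; rewrite vliftK /= linearB /= -[RHS]subr0; congr (_ - _); apply/eqP.
by rewrite -memv_ker (subvP Uf) // memv_proj.
Qed.

End Quotient.

(* U (x)_k V in coordinates with respect to vbasis; the universal property is
   kliftE and ktens_ext. *)
Section TensorK.

Variables U V : vectType k.

Definition ktensor : vectType k := 'M[k]_(\dim {:U}, \dim {:V}).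

Definition ktens (u : U) (v : V) : ktensor :=
  \matrix_(i, j) (coord (vbasis {:U}) i u * coord (vbasis {:V}) j v).

Definition klift (W : vectType k) (b : U -> V -> W) : 'Hom(ktensor, W) :=
  linfun (fun X : ktensor =>
    \sum_i \sum_j X i j *: b (vbasis {:U})`_i (vbasis {:V})`_j).

Lemma ktens_bilin : bilin ktens.
Proof.
split=> w c x y; apply/matrixP=> i j; rewrite !mxE linearP /=.
  by rewrite mulrDl mulrA.
by rewrite mulrDr mulrCA.
Qed.

Lemma bilin_suml (W : vectType k) (b : U -> V -> W) I (r : seq I) F c v :
  bilin b -> b (\sum_(i <- r) c i *: F i) v = \sum_(i <- r) c i *: b (F i) v.
Proof.
case=> bl _; elim: r => [|x r IH]; last by rewrite !big_cons bl IH.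
by rewrite !big_nil -(addNr 0) -scaleN1r bl scaleN1r addNr.
Qed.

Lemma bilin_sumr (W : vectType k) (b : U -> V -> W) I (r : seq I) F c u :
  bilin b -> b u (\sum_(i <- r) c i *: F i) = \sum_(i <- r) c i *: b u (F i).
Proof.
case=> _ br; elim: r => [|x r IH]; last by rewrite !big_cons br IH.
by rewrite !big_nil -(addNr 0) -scaleN1r br scaleN1r addNr.
Qed.

Lemma bilinl_sum (W : vectType k) (b : U -> V -> W) I (r : seq I) F v :
  bilin b -> b (\sum_(i <- r) F i) v = \sum_(i <- r) b (F i) v.
Proof.
move=> bb; have := bilin_suml r F (fun=> 1) v bb.
by under eq_bigr do rewrite scale1r; under [RHS]eq_bigr do rewrite scale1r.
Qed.

Lemma bilinr_sum (W : vectType k) (b : U -> V -> W) I (r : seq I) F u :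
  bilin b -> b u (\sum_(i <- r) F i) = \sum_(i <- r) b u (F i).
Proof.
move=> bb; have := bilin_sumr r F (fun=> 1) u bb.
by under eq_bigr do rewrite scale1r; under [RHS]eq_bigr do rewrite scale1r.
Qed.

Lemma kliftE (W : vectType k) (b : U -> V -> W) u v :
  bilin b -> klift b (ktens u v) = b u v.
Proof.
move=> bb; rewrite linfunE => [|c X Y]; last first.
  rewrite scaler_sumr -big_split /=; apply: eq_bigr => i _.
  rewrite scaler_sumr -big_split /=; apply: eq_bigr => j _.
  by rewrite !mxE scalerDl scalerA.
rewrite [in RHS](coord_vbasis (memvf u)) (bilin_suml _ _ _ _ bb).
apply: eq_bigr => i _.
rewrite [in RHS](coord_vbasis (memvf v)) (bilin_sumr _ _ _ _ bb) scaler_sumr.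
by apply: eq_bigr => j _; rewrite mxE scalerA.
Qed.

Lemma ktens_sum (X : ktensor) :
  X = \sum_i \sum_j X i j *: ktens (vbasis {:U})`_i (vbasis {:V})`_j.
Proof.
have fU := basis_free (vbasisP {:U}); have fV := basis_free (vbasisP {:V}).
apply/matrixP => p q; rewrite summxE (bigD1 p) //= summxE (bigD1 q) //=.
rewrite !mxE !coord_free // !eqxx !mulr1 big1 => [|j /negPf jq]; last first.
  by rewrite !mxE !coord_free // jq !mulr0.
rewrite addr0 big1 ?addr0 // => i /negPf ip; rewrite summxE big1 // => j _.
by rewrite !mxE !coord_free // ip mul0r mulr0.
Qed.

Lemma ktens_ext (W : vectType k) (f g : 'Hom(ktensor, W)) :
  (forall u v, f (ktens u v) = g (ktens u v)) -> f = g.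
Proof.
move=> fg; apply/lfunP => X; rewrite (ktens_sum X) !linear_sum.
apply: eq_bigr => i _; rewrite !linear_sum; apply: eq_bigr => j _.
by rewrite !linearZ /= fg.
Qed.

End TensorK.

Lemma linear_mem (U V : vectType k) (S : {vspace V}) (h : U -> V) :
  linear h -> (forall x, x \in vbasis {:U} -> h x \in S) -> forall u, h u \in S.
Proof.
move=> lh hS u; rewrite -(linfunE lh) (coord_vbasis (memvf u)) linear_sum.
apply: memv_suml => i _; rewrite linearZ /= memvZ // linfunE // hS //.
by apply: mem_nth; rewrite size_tuple.
Qed.

End LinearAlgebra.

Section Modules.

Variables (k : fieldType) (A : falgType k).

Record lmod := LMod {
  lcarrier :> vectType k;
  lact : A -> lcarrier -> lcarrier;
  lact_bilin : bilin lact;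
  lact1 : forall m, lact 1 m = m;
  lactM : forall a b m, lact (a * b) m = lact a (lact b m) }.

Record rmod := RMod {
  rcarrier :> vectType k;
  ract : rcarrier -> A -> rcarrier;
  ract_bilin : bilin ract;
  ract1 : forall x, ract x 1 = x;
  ractM : forall x a b, ract x (a * b) = ract (ract x a) b }.

Record bimod := BiMod {
  bcarrier :> vectType k;
  blact : A -> bcarrier -> bcarrier;
  bract : bcarrier -> A -> bcarrier;
  blact_bilin : bilin blact;
  bract_bilin : bilin bract;
  blact1 : forall s, blact 1 s = s;
  bract1 : forall s, bract s 1 = s;
  blactM : forall a b s, blact (a * b) s = blact a (blact b s);
  bractM : forall s a b, bract s (a * b) = bract (bract s a) b;
  blact_ract : forall a s b, bract (blact a s) b = blact a (bract s b) }.

Definition bimod_left (S : bimod) : lmod :=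
  LMod (blact_bilin S) (@blact1 S) (@blactM S).

Definition bimod_right (S : bimod) : rmod :=
  RMod (bract_bilin S) (@bract1 S) (@bractM S).

Fact mul_bilin : bilin (fun a b : A => a * b).
Proof.
split=> w c x y; first by rewrite mulrDl -scalerAl.
by rewrite mulrDr -scalerAr.
Qed.

Definition regular_lmod : lmod :=
  LMod mul_bilin (@mul1r A) (fun a b m => esym (mulrA a b m)).

Section Hom.

Variables M N : lmod.

Definition hom_defect (a : A) (f : 'Hom(M, N)) : 'Hom(M, N) :=
  ((f \o linfun (lact (l := M) a)) - (linfun (lact (l := N) a) \o f))%VF.

(* It is enough to commute with a basis of A; see mem_HomA. *)
Definition HomA : {vspace 'Hom(M, N)} :=
  (\bigcap_(a <- vbasis {:A}) lker (linfun (hom_defect a)))%VS.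

Lemma lactE (L : lmod) a : linfun (lact (l := L) a) =1 lact (l := L) a.
Proof. by apply: linfunE; case: (lact_bilin L). Qed.

Lemma hom_defectE a (f : 'Hom(M, N)) m :
  hom_defect a f m = f (lact a m) - lact a (f m).
Proof. by rewrite add_lfunE opp_lfunE !comp_lfunE !lactE. Qed.

Lemma mem_HomA (f : 'Hom(M, N)) :
  f \in HomA <-> forall a m, f (lact a m) = lact a (f m).
Proof.
have cl a : linear (hom_defect a).
  move=> c g h; apply/lfunP => m; rewrite !(hom_defectE, lfunE) /=.
  rewrite !(hom_defectE, add_lfunE, scale_lfunE).
  by case: (lact_bilin N) => _ ->; rewrite scalerBr opprD addrACA.
have -> : (f \in HomA) = all (fun a => hom_defect a f == 0) (vbasis {:A}).
  rewrite /HomA; elim: (tval _) => [|a r IH].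
    by rewrite big_nil memvf.
  by rewrite big_cons memv_cap IH memv_ker linfunE.
split=> [/allP f0 a m | fA]; last first.
  apply/allP => a _; apply/eqP/lfunP => m.
  by rewrite hom_defectE fA subrr zero_lfunE.
apply/eqP; rewrite -subr_eq0 -memv0.
apply: (@linear_mem _ A N 0%VS (fun a => f (lact a m) - lact a (f m))).
  move=> c x y; case: (lact_bilin M) => -> _; case: (lact_bilin N) => -> _.
  by rewrite linearP scalerBr opprD addrACA.
by move=> x /f0 /eqP fx; rewrite memv0 -hom_defectE fx zero_lfunE.
Qed.

Definition homA : Type := subvs_of HomA.
HB.instance Definition _ := Vector.on homA.

Definition hfun (f : homA) : 'Hom(M, N) := vsval f.
Coercion hfun : homA >-> hom.

Lemma homA_lact (f : homA) a m : f (lact a m) = lact a (f m).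
Proof. by have /mem_HomA := subvsP f. Qed.

Lemma homA_eqP (f g : homA) : (forall m, f m = g m) -> f = g.
Proof. by move=> fg; apply: val_inj; apply/lfunP. Qed.

Lemma homA_linE c (f g : homA) m : hfun (c *: f + g) m = c *: f m + g m.
Proof. by rewrite /hfun /= add_lfunE scale_lfunE. Qed.

Fact mkhom_subproof (f : M -> N) (fl : linear f)
  (fA : forall a m, f (lact a m) = lact a (f m)) : linfun f \in HomA.
Proof. by apply/mem_HomA => a m; rewrite !linfunE. Qed.

Definition mkhom f fl fA : homA := Subvs (@mkhom_subproof f fl fA).

Lemma mkhomE f fl fA m : @mkhom f fl fA m = f m.
Proof. exact: (linfunE fl). Qed.

End Hom.

Fact hcomp_subproof (L M N : lmod) (g : homA M N) (f : homA L M) :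
  (hfun g \o hfun f)%VF \in HomA L N.
Proof. by apply/mem_HomA => a m; rewrite !comp_lfunE !homA_lact. Qed.

Definition hcomp (L M N : lmod) (g : homA M N) (f : homA L M) : homA L N :=
  Subvs (hcomp_subproof g f).

Lemma hcompE (L M N : lmod) (g : homA M N) (f : homA L M) x :
  hcomp g f x = g (f x).
Proof. exact: comp_lfunE. Qed.

Definition projective (P : lmod) : Prop :=
  forall (M N : lmod) (g : homA M N) (f : homA P N),
    (forall y, exists x, g x = y) -> exists h : homA P M, hcomp g h = f.

Record proj := Proj { pmod :> lmod; pmodP : projective pmod }.

Lemma memv_sum_seq (T : eqType) (V : vectType k) (r : seq T) (i : T)
    (F : T -> {vspace V}) v :
  i \in r -> v \in F i -> v \in (\sum_(j <- r) F j)%VS.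
Proof.
elim: r => // j r IH; rewrite inE big_cons => /orP[/eqP-> vF|ir vF].
  by rewrite (subvP (addvSl _ _)).
by rewrite (subvP (addvSr _ _)) ?IH.
Qed.

Section TensorA.

Variables (X : rmod) (Y : lmod).

Definition balanced (W : lmodType k) (b : X -> Y -> W) : Prop :=
  forall x a y, b (ract x a) y = b x (lact a y).

Definition tensor_rel : {vspace ktensor X Y} :=
  (\sum_(x <- vbasis {:X}) \sum_(a <- vbasis {:A}) \sum_(y <- vbasis {:Y})
     <[ktens (ract x a) y - ktens x (lact a y)]>)%VS.

Definition tensor : vectType k := vquot tensor_rel.

Definition tens (x : X) (y : Y) : tensor := vpi tensor_rel (ktens x y).

(* Meaningful only for b bilinear and balanced; see tliftE. *)
Definition tlift (W : vectType k) (b : X -> Y -> W) : 'Hom(tensor, W) :=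
  vlift tensor_rel (klift b).

Lemma mem_tensor_rel x a y :
  ktens (ract x a) y - ktens x (lact a y) \in tensor_rel.
Proof.
have [tl tr] := ktens_bilin X Y.
have [rl rr] := ract_bilin X; have [ll lr] := lact_bilin Y.
move: x; apply: (@linear_mem _ X (ktensor X Y)) => [c u v|x xb].
  by rewrite rl !tl scalerBr opprD addrACA.
move: a; apply: (@linear_mem _ A (ktensor X Y)) => [c u v|a ab].
  by rewrite rr ll tl tr scalerBr opprD addrACA.
move: y; apply: (@linear_mem _ Y (ktensor X Y)) => [c u v|y yb].
  by rewrite lr !tr scalerBr opprD addrACA.
apply: (memv_sum_seq xb); apply: (memv_sum_seq ab); apply: (memv_sum_seq yb).
exact: memv_line.
Qed.

Lemma tens_bilin : bilin tens.
Proof.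
have [tl tr] := ktens_bilin X Y.
by split=> w c u v; rewrite /tens ?tl ?tr linearP.
Qed.

Lemma tens_balanced : balanced tens.
Proof.
move=> x a y; apply/eqP; rewrite -subr_eq0 -linearB /= vpi_eq0.
exact: mem_tensor_rel.
Qed.

Lemma tliftE (W : vectType k) (b : X -> Y -> W) x y :
  bilin b -> balanced b -> tlift b (tens x y) = b x y.
Proof.
move=> bb bal; rewrite vliftE ?kliftE //.
rewrite /tensor_rel; elim/big_rec: _ => [|i U _ IH]; first exact: sub0v.
rewrite subv_add IH andbT.
elim/big_rec: _ => [|a V _ IHa]; first exact: sub0v.
rewrite subv_add IHa andbT.
elim/big_rec: _ => [|z Z _ IHz]; first exact: sub0v.
rewrite subv_add IHz andbT -memvE memv_ker linearB /= !kliftE //.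
by rewrite bal subrr.
Qed.

Lemma tens_ext (W : vectType k) (f g : 'Hom(tensor, W)) :
  (forall x y, f (tens x y) = g (tens x y)) -> f = g.
Proof.
move=> fg; have pl : linear (vpi tensor_rel) := @vpi_linear _ _ _.
have E : (f \o linfun (vpi tensor_rel) = g \o linfun (vpi tensor_rel))%VF.
  by apply: ktens_ext => x y; rewrite !comp_lfunE linfunE //; apply: fg.
apply/lfunP => q; rewrite -(vpiK q).
by have /lfunP/(_ (vsval q)) := E; rewrite !comp_lfunE linfunE.
Qed.

End TensorA.

Lemma tens_ind (X : rmod) (Y : lmod) (K : tensor X Y -> Prop) :
  (forall c u v, K u -> K v -> K (c *: u + v)) ->
  (forall x y, K (tens x y)) -> forall z, K z.
Proof.
move=> KD Kt z; rewrite -(vpiK z) (ktens_sum (vsval z)).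
have [tl tr] := tens_bilin X Y.
have K0 : K 0 by rewrite -(addNr (tens 0 0)) -scaleN1r; apply: KD.
have Ksum I (r : seq I) (F : I -> tensor X Y) :
    (forall i, K (F i)) -> K (\sum_(i <- r) F i).
  move=> KF; apply: (big_ind K) => // u v Ku Kv.
  by rewrite -[u]scale1r; apply: KD.
rewrite linear_sum; apply: (Ksum) => i; rewrite linear_sum; apply: (Ksum) => j.
by rewrite linearZ /= -[_ *: _]addr0; apply: KD; [apply: Kt | apply: K0].
Qed.

Section Twist.

Variable S : bimod.

Definition ptens (M : lmod) (s : S) (m : M) : tensor (bimod_right S) M :=
  tens (X := bimod_right S) s m.

Lemma ptens_bilin (M : lmod) : bilin (@ptens M).
Proof. exact: (@tens_bilin (bimod_right S)). Qed.

Lemma ptens_balanced (M : lmod) (s : S) a (m : M) :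
  ptens (bract s a) m = ptens s (lact a m).
Proof. exact: (@tens_balanced (bimod_right S)). Qed.

Lemma ptens_ind (M : lmod) (K : tensor (bimod_right S) M -> Prop) :
  (forall c u v, K u -> K v -> K (c *: u + v)) ->
  (forall s m, K (ptens s m)) -> forall z, K z.
Proof. exact: (@tens_ind (bimod_right S)). Qed.

Fact twist_act_subproof (M : lmod) (a : A) :
  let b := fun (s : S) (m : M) => ptens (blact a s) m in
  bilin b /\ @balanced (bimod_right S) M _ b.
Proof.
have [tl tr] := ptens_bilin M; have [bl br] := blact_bilin S.
split; first by split=> w c u v /=; rewrite ?br ?tl ?tr.
by move=> s c m /=; rewrite -ptens_balanced blact_ract.
Qed.

Definition twist_act (M : lmod) (a : A) :
    'End(tensor (bimod_right S) M) :=
  tlift (X := bimod_right S) (fun (s : S) m => ptens (blact a s) m).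

Lemma twist_actE (M : lmod) a (s : S) (m : M) :
  twist_act M a (ptens s m) = ptens (blact a s) m.
Proof. by have [b1 b2] := twist_act_subproof M a; rewrite [LHS]tliftE. Qed.

Fact twist_bilin (M : lmod) : bilin (twist_act M).
Proof.
have [tl tr] := ptens_bilin M.
have [bl br] := blact_bilin S.
split=> [z c a b|a]; last exact: linearP.
elim/ptens_ind: z => [d u v IHu IHv|s m].
  by rewrite !linearP /= IHu IHv !scalerDr !scalerA addrACA !addrA.
by rewrite !twist_actE bl tl.
Qed.

Fact twist1 (M : lmod) z : twist_act M 1 z = z.
Proof.
elim/ptens_ind: z => [c u v IHu IHv|s m].
  by rewrite linearP /= IHu IHv.
by rewrite twist_actE blact1.
Qed.

Fact twistM (M : lmod) a b z :
  twist_act M (a * b) z = twist_act M a (twist_act M b z).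
Proof.
elim/ptens_ind: z => [c u v IHu IHv|s m].
  by rewrite !linearP /= IHu IHv.
by rewrite !twist_actE blactM.
Qed.

Definition twist (M : lmod) : lmod :=
  LMod (twist_bilin M) (@twist1 M) (@twistM M).

Lemma lact_ptens (M : lmod) a (s : S) (m : M) :
  lact (l := twist M) a (ptens s m) = ptens (blact a s) m.
Proof. exact: twist_actE. Qed.

Section Map.

Variables (M N : lmod) (f : homA M N).

Definition twist_fun : 'Hom(twist M, twist N) :=
  tlift (X := bimod_right S) (fun (s : S) m => ptens s (f m)).

Lemma twist_funE s m : twist_fun (ptens s m) = ptens s (f m).
Proof.
have [tl tr] := ptens_bilin N.
rewrite /twist_fun [LHS]tliftE //.
  by split=> w c u v; rewrite ?linearP ?tl ?tr.
by move=> t a n; rewrite homA_lact; apply: ptens_balanced.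
Qed.

Fact twist_fun_subproof : twist_fun \in HomA (twist M) (twist N).
Proof.
apply/mem_HomA => a; elim/ptens_ind => [c u v IHu IHv|s m].
  have [_ ll] := lact_bilin (twist M); have [_ lr] := lact_bilin (twist N).
  by rewrite ll linearP /= IHu IHv -lr linearP.
by rewrite [lact _ _]lact_ptens !twist_funE lact_ptens.
Qed.

Definition twist_map : homA (twist M) (twist N) := Subvs twist_fun_subproof.

End Map.

End Twist.

Section Dual.

Variable P : lmod.

Fact dual_act_subproof (f : homA P regular_lmod) (a : A) :
  linear (fun p => f p * a) /\
  forall b p, (f (lact b p) : A) * a = lact (l := regular_lmod) b (f p * a).
Proof.
split=> [c u v|b p]; first by rewrite linearP /= mulrDl -scalerAl.
by rewrite homA_lact /= mulrA.
Qed.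

Definition dual_act (f : homA P regular_lmod) (a : A) : homA P regular_lmod :=
  mkhom (N := regular_lmod) (proj1 (dual_act_subproof f a))
    (proj2 (dual_act_subproof f a)).

Lemma dual_actE f a p : dual_act f a p = (f p : A) * a.
Proof. exact: mkhomE. Qed.

Fact dual_act_bilin : bilin dual_act.
Proof.
split=> w c u v; apply: homA_eqP => p; rewrite !(dual_actE, homA_linE).
  by rewrite mulrDl -scalerAl.
by rewrite mulrDr -scalerAr.
Qed.

Fact dual_act1 f : dual_act f 1 = f.
Proof. by apply: homA_eqP => p; rewrite dual_actE mulr1. Qed.

Fact dual_actM f a b : dual_act f (a * b) = dual_act (dual_act f a) b.
Proof. by apply: homA_eqP => p; rewrite !dual_actE mulrA. Qed.

Definition dual : rmod := RMod dual_act_bilin dual_act1 dual_actM.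

End Dual.

Section Theta.

Variables P M : lmod.

Fact theta_hom_subproof (f : dual P) (m : M) :
  linear (fun p => lact (hfun f p : A) m) /\
  forall b p, lact (hfun f (lact b p) : A) m = lact b (lact (hfun f p : A) m).
Proof.
have [ll lr] := lact_bilin M; split=> [c u v|b p].
  by rewrite linearP ll.
by rewrite homA_lact /= lactM.
Qed.

Definition theta_hom (f : dual P) (m : M) : homA P M :=
  mkhom (proj1 (theta_hom_subproof f m)) (proj2 (theta_hom_subproof f m)).

Lemma theta_homE f m p : theta_hom f m p = lact (hfun f p : A) m.
Proof. exact: mkhomE. Qed.

Fact theta_bilin : bilin theta_hom.
Proof.
have [ll lr] := lact_bilin M.
split=> w c u v; apply: homA_eqP => q; rewrite homA_linE !theta_homE.
  by rewrite homA_linE ll.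
by rewrite lr.
Qed.

Fact theta_balanced : balanced theta_hom.
Proof.
by move=> f a m; apply: homA_eqP => q; rewrite !theta_homE dual_actE lactM.
Qed.

Definition theta : 'Hom(tensor (dual P) M, homA P M) := tlift theta_hom.

Lemma thetaE f m : theta (tens f m) = theta_hom f m.
Proof. by rewrite tliftE; [|exact: theta_bilin|exact: theta_balanced]. Qed.

End Theta.

Section DualBasis.

Section Free.

Variable n : nat.

Definition free_act (a : A) (v : {ffun 'I_n -> A}) : {ffun 'I_n -> A} :=
  [ffun i => a * v i].

Fact free_bilin : bilin free_act.
Proof.
split=> w c u v; apply/ffunP => i; rewrite !ffunE.
  by rewrite mulrDl -scalerAl.
by rewrite mulrDr -scalerAr.
Qed.

Fact free_act1 v : free_act 1 v = v.
Proof. by apply/ffunP => i; rewrite !ffunE mul1r. Qed.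

Fact free_actM a b v : free_act (a * b) v = free_act a (free_act b v).
Proof. by apply/ffunP => i; rewrite !ffunE mulrA. Qed.

Definition free_lmod : lmod := LMod free_bilin free_act1 free_actM.

End Free.

Lemma lact_scale (M : lmod) c a (m : M) : lact (c *: a) m = c *: lact a m.
Proof.
have [ll _] := lact_bilin M.
have l0 : lact 0 m = 0 by rewrite -(addNr 0) -scaleN1r ll scaleN1r addNr.
by rewrite -[c *: a]addr0 ll l0 addr0.
Qed.

Lemma lact_sumr (M : lmod) a I (r : seq I) (F : I -> M) :
  lact a (\sum_(i <- r) F i) = \sum_(i <- r) lact a (F i).
Proof. exact: (@bilinr_sum k A M M (@lact M) I r F a (lact_bilin M)). Qed.

Lemma dual_basis (P : lmod) : projective P ->
  exists n (e : 'I_n -> P) (d : 'I_n -> dual P),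
    forall p, p = \sum_i lact (hfun (d i) p : A) (e i).
Proof.
move=> Pproj; pose n := \dim {:P}; pose e (i : 'I_n) := (vbasis {:P})`_i.
pose g0 (v : free_lmod n) : P := \sum_i lact ((v : {ffun _ -> A}) i) (e i).
have [ll lr] := lact_bilin P.
have g0l : linear g0.
  move=> c u v; rewrite scaler_sumr -big_split; apply: eq_bigr => i _ /=.
  by rewrite !ffunE ll.
have g0A a v : g0 (lact a v) = lact a (g0 v).
  by rewrite lact_sumr; apply: eq_bigr => i _; rewrite ffunE lactM.
have idl : linear (fun p : P => p) by [].
have [|h hK] := Pproj _ _ (mkhom g0l g0A) (mkhom idl (fun a m => erefl)).
  move=> y; exists [ffun i => (coord (vbasis {:P}) i y)%:A].
  rewrite mkhomE /g0 [RHS](coord_vbasis (memvf y)); apply: eq_bigr => i _.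
  by rewrite ffunE lact_scale lact1.
have hl i : linear (fun p => (hfun h p : {ffun _ -> A}) i).
  by move=> c u v; rewrite linearP !ffunE.
have hA i a p : (hfun h (lact a p) : {ffun _ -> A}) i
    = lact (l := regular_lmod) a ((hfun h p : {ffun _ -> A}) i).
  by rewrite homA_lact !ffunE.
exists n, e, (fun i => mkhom (N := regular_lmod) (hl i) (hA i)) => p.
have /(congr1 (fun f => hfun f p)) := hK.
rewrite hcompE !mkhomE => E; rewrite -[LHS]E.
by apply: eq_bigr => i _; rewrite mkhomE.
Qed.

Lemma theta_bij (P M : lmod) : projective P -> bijective (theta P M).
Proof.
case/dual_basis => n [e [d dE]].
have [tl tr] := tens_bilin (dual P) M.
pose r (f : homA P M) : tensor (dual P) M := \sum_i tens (d i) (f (e i)).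
have rl : linear r.
  move=> c f g; rewrite scaler_sumr -big_split; apply: eq_bigr => i _ /=.
  by rewrite homA_linE tr.
exists r => [z|f]; last first.
  apply: homA_eqP => p; rewrite [in RHS](dE p) linear_sum.
  rewrite linear_sum /= /hfun linear_sum sum_lfunE; apply: eq_bigr => i _.
  by rewrite thetaE -/(hfun _) theta_homE homA_lact.
elim/tens_ind: z => [c u v IHu IHv|f m]; first by rewrite linearP rl IHu IHv.
rewrite thetaE /r.
under eq_bigr do rewrite theta_homE -tens_balanced.
have fE : f = \sum_i ract (d i) (hfun f (e i) : A).
  apply: homA_eqP => p; rewrite /hfun linear_sum sum_lfunE /=.
  rewrite -/(hfun f) {1}(dE p) linear_sum; apply: eq_bigr => i _.
  rewrite -[RHS]/(hfun (dual_act (d i) (hfun f (e i))) p) dual_actE.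
  exact: (homA_lact f).
rewrite [in RHS]fE.
by rewrite (bilinl_sum _ _ _ (tens_bilin (dual P) M)).
Qed.

End DualBasis.

Section HH0.

Variable S : bimod.

Definition HH0_rel : {vspace S} :=
  (\sum_(a <- vbasis {:A}) \sum_(s <- vbasis {:S})
     <[blact a s - bract s a]>)%VS.

Definition HH0 : vectType k := vquot HH0_rel.

Definition HH0_class (s : S) : HH0 := vpi HH0_rel s.

HB.instance Definition _ :=
  GRing.isLinear.Build k S HH0 *:%R HH0_class (@vpi_linear _ _ HH0_rel).

Lemma mem_HH0_rel a (s : S) : blact a s - bract s a \in HH0_rel.
Proof.
have [ll lr] := blact_bilin S; have [rl rr] := bract_bilin S.
move: a; apply: (@linear_mem _ A S) => [c u v|a ab].
  by rewrite ll rr scalerBr opprD addrACA.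
move: s; apply: (@linear_mem _ S S) => [c u v|s sb].
  by rewrite lr rl scalerBr opprD addrACA.
by apply: (memv_sum_seq ab); apply: (memv_sum_seq sb); apply: memv_line.
Qed.

Lemma HH0_classC a (s : S) : HH0_class (blact a s) = HH0_class (bract s a).
Proof.
by apply/eqP; rewrite -subr_eq0 -linearB /= vpi_eq0 mem_HH0_rel.
Qed.

(* HH_0(S)^* is identified with the central elements of S^*; for central l,
   HH0_form l is the induced form on HH_0(S), see HH0_formE. *)
Definition central (l : 'Hom(S, k^o)) : Prop :=
  forall (s : S) (a : A), l (bract s a) = l (blact a s).

Definition HH0_form (l : 'Hom(S, k^o)) : 'Hom(HH0, k^o) := vlift HH0_rel l.

Lemma HH0_formE l s : central l -> HH0_form l (HH0_class s) = l s.
Proof.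
move=> lC; rewrite [LHS]vliftE // /HH0_rel.
elim/big_rec: _ => [|a V _ IHa]; first exact: sub0v.
rewrite subv_add IHa andbT.
elim/big_rec: _ => [|z Z _ IHz]; first exact: sub0v.
by rewrite subv_add IHz andbT -memvE memv_ker linearB /= lC subrr.
Qed.

(* The map P^dagger (x)_A S (x)_A P -> HH_0(S), f (x) s (x) p |-> [f(p) s]. *)
Section Contraction.

Variable P : lmod.

Definition contr1 (f : dual P) : 'Hom(twist S P, HH0) :=
  tlift (X := bimod_right S) (Y := P)
    (fun (s : S) p => HH0_class (blact (hfun f p : A) s)).

Lemma contr1E f s p :
  contr1 f (ptens s p) = HH0_class (blact (hfun f p : A) s).
Proof.
have [ll lr] := blact_bilin S.
rewrite [LHS]tliftE //.
  by split=> w c u v; rewrite ?linearP ?ll ?lr linearP.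
move=> t a q.
have fE : hfun f (lact a q) = a * hfun f q :> A := homA_lact f a q.
by cbn beta; rewrite fE blactM [RHS]HH0_classC blact_ract.
Qed.

Fact contr_bilin : bilin (fun (f : dual P) (z : twist S P) => contr1 f z).
Proof.
have [ll lr] := blact_bilin S.
split=> [z c f g|f c u v]; last exact: linearP.
elim/ptens_ind: z => [d u v IHu IHv|s p].
  by rewrite !linearP /= IHu IHv !scalerDr !scalerA addrACA [d * c]mulrC.
by rewrite !contr1E homA_linE ll linearP.
Qed.

Fact contr_balanced :
  balanced (fun (f : dual P) (z : twist S P) => contr1 f z).
Proof.
move=> f a; elim/ptens_ind => [c u v IHu IHv|s p].
  have [_ lr] := lact_bilin (twist S P).
  by rewrite lr !linearP /= IHu IHv.
by rewrite lact_ptens !contr1E dual_actE blactM.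
Qed.

Definition contr : 'Hom(tensor (dual P) (twist S P), HH0) :=
  tlift (fun (f : dual P) (z : twist S P) => contr1 f z).

Lemma contrE (f : dual P) (s : S) (p : P) :
  contr (tens f (ptens s p : twist S P)) = HH0_class (blact (hfun f p : A) s).
Proof.
rewrite [LHS]tliftE; [exact: contr1E|exact: contr_bilin|exact: contr_balanced].
Qed.

(* theta^-1 is the actual inverse when P is projective, by theta_bij. *)
Definition universal_trace : 'Hom(homA P (twist S P), HH0) :=
  (contr \o (theta P (twist S P))^-1)%VF.

End Contraction.

Lemma universal_traceE (P : lmod) z : projective P ->
  universal_trace P (theta P (twist S P) z) = contr P z.
Proof.
move=> /(@theta_bij _ (twist S P))/bij_inj inj.
by rewrite comp_lfunE lker0_lfunK //; apply/lker0P.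
Qed.

Lemma universal_trace_cyclic (P Q : proj) (f : homA P Q)
    (g : homA Q (twist S P)) :
  universal_trace P (hcomp g f) = universal_trace Q (hcomp (twist_map S f) g).
Proof.
have [r _ rK] := @theta_bij Q (twist S P) (@pmodP Q); rewrite -(rK g).
have hl (L M N : lmod) (h : homA M N) c (u v : homA L M) :
    hcomp h (c *: u + v) = c *: hcomp h u + hcomp h v.
  by apply: homA_eqP => m; rewrite !(hcompE, homA_linE) linearP.
have hr (L M N : lmod) (h : homA L M) c (u v : homA M N) :
    hcomp (c *: u + v) h = c *: hcomp u h + hcomp v h.
  by apply: homA_eqP => m; rewrite !(hcompE, homA_linE).
elim/tens_ind: (r g) => [c u v IHu IHv|q].
  by rewrite !linearP hl hr !linearP /= IHu IHv.
elim/ptens_ind => [c u v IHu IHv|s p].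
  have [_ tr] := tens_bilin (dual Q) (twist S P).
  by rewrite tr !linearP hl hr !linearP /= IHu IHv.
have -> : hcomp (theta Q (twist S P) (tens q (ptens s p : twist S P))) f
    = theta P (twist S P) (tens (hcomp q f : dual P) (ptens s p : twist S P)).
  by apply: homA_eqP => m; rewrite hcompE !thetaE !theta_homE hcompE.
have -> : hcomp (twist_map S f)
      (theta Q (twist S P) (tens q (ptens s p : twist S P)))
    = theta Q (twist S Q) (tens q (ptens s (f p) : twist S Q)).
  apply: homA_eqP => m; rewrite hcompE !thetaE !theta_homE.
  by rewrite !lact_ptens [LHS]twist_funE.
by rewrite !universal_traceE ?contrE ?hcompE //; apply: pmodP.
Qed.

Record twisted_trace := TwistedTrace {
  ttr :> forall P : proj, 'Hom(homA P (twist S P), k^o);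
  ttrC : forall (P Q : proj) (f : homA P Q) (g : homA Q (twist S P)),
    ttr P (hcomp g f) = ttr Q (hcomp (twist_map S f) g) }.

Definition trace_pairing (t : twisted_trace) (M : lmod) (P : proj)
    (f : homA M (twist S P)) (g : homA P M) : k :=
  t P (hcomp f g).

Definition nondegenerate_trace (t : twisted_trace) : Prop :=
  forall (M : lmod) (P : proj), nondegenerate_pairing (@trace_pairing t M P).

Section TraceOf.

Variable l : 'Hom(S, k^o).

Definition trace_of_fun (P : proj) : 'Hom(homA P (twist S P), k^o) :=
  (HH0_form l \o universal_trace P)%VF.

Fact trace_of_subproof (P Q : proj) (f : homA P Q) (g : homA Q (twist S P)) :
  trace_of_fun P (hcomp g f) = trace_of_fun Q (hcomp (twist_map S f) g).
Proof. by rewrite [LHS]comp_lfunE [RHS]comp_lfunE universal_trace_cyclic. Qed.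

Definition trace_of : twisted_trace := TwistedTrace trace_of_subproof.

End TraceOf.

End HH0.

Section DualBimodule.

Notation Adual := 'Hom(A, k^o).

Definition dual_l (a : A) (f : Adual) : Adual := linfun (fun b => f (b * a)).
Definition dual_r (f : Adual) (a : A) : Adual := linfun (fun b => f (a * b)).

Lemma dual_lE a f b : dual_l a f b = f (b * a).
Proof.
by rewrite [LHS]linfunE // => c u v; rewrite mulrDl -scalerAl linearP.
Qed.

Lemma dual_rE f a b : dual_r f a b = f (a * b).
Proof.
by rewrite [LHS]linfunE // => c u v; rewrite mulrDr -scalerAr linearP.
Qed.

Definition dualE := (dual_lE, dual_rE, add_lfunE, scale_lfunE).

Fact dual_l_bilin : bilin dual_l.
Proof.
split=> w c u v; apply/lfunP => b; rewrite !dualE //.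
by rewrite mulrDr -scalerAr linearP.
Qed.

Fact dual_r_bilin : bilin dual_r.
Proof.
split=> w c u v; apply/lfunP => b; rewrite !dualE //.
by rewrite mulrDl -scalerAl linearP.
Qed.

Fact dual_l1 f : dual_l 1 f = f.
Proof. by apply/lfunP => b; rewrite !dualE mulr1. Qed.

Fact dual_r1 f : dual_r f 1 = f.
Proof. by apply/lfunP => b; rewrite !dualE mul1r. Qed.

Fact dual_lM a b f : dual_l (a * b) f = dual_l a (dual_l b f).
Proof. by apply/lfunP => c; rewrite !dualE mulrA. Qed.

Fact dual_rM f a b : dual_r f (a * b) = dual_r (dual_r f a) b.
Proof. by apply/lfunP => c; rewrite !dualE mulrA. Qed.

Fact dual_lr a f b : dual_r (dual_l a f) b = dual_l a (dual_r f b).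
Proof. by apply/lfunP => c; rewrite !dualE mulrA. Qed.

Definition dual_bimod : bimod :=
  BiMod dual_l_bilin dual_r_bilin dual_l1 dual_r1 dual_lM dual_rM dual_lr.

End DualBimodule.

Definition bimod_iso (S T : bimod) (phi : 'Hom(S, T)) : Prop :=
  [/\ forall a s, phi (blact a s) = blact a (phi s),
      forall s a, phi (bract s a) = bract (phi s) a
    & bijective phi].

Definition natural_map (S : bimod) (l : 'Hom(S, k^o)) : 'Hom(S, dual_bimod) :=
  linfun (fun s : S => linfun (fun a : A => l (blact a s)) : 'Hom(A, k^o)).

Lemma natural_mapE (S : bimod) (l : 'Hom(S, k^o)) (s : S) (a : A) :
  (natural_map l s : 'Hom(A, k^o)) a = l (blact a s).
Proof.
have [ll lr] := blact_bilin S.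
have E t : linfun (fun a : A => l (blact a t)) =1 (fun a => l (blact a t)).
  by apply: linfunE => c u v; rewrite ll linearP.
rewrite linfunE; first exact: E.
move=> c u v; apply/lfunP => b.
by rewrite add_lfunE scale_lfunE !E lr linearP.
Qed.

End Modules.

(* Main.v *)
(* For d in P^dagger let ev_d : Sigma(P) -> Sigma send s (x) p to s d(p).  The
   pairing of f : M -> Sigma(P) with theta(d (x) m) is lambda(ev_d(f(m))), so f
   in the left radical satisfies lambda(a ev_d(f(m))) = 0 for all a, and vanishes
   when lambda^nat is injective, by a dual basis of P.  For the right radical,
   bijectivity of lambda^nat lets one write down, for each linear form phi on
   Hom_A(P, M), an f : M -> Sigma(P) whose pairing is phi.  Conversely, a twisted
   trace t determines lambda(s) = t_A(a |-> a s (x) 1), and t_A restricted to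
   Hom_A(A, Sigma(A)) x Hom_A(A, A) = Sigma x A is the pairing lambda(a s), whose
   nondegeneracy makes lambda^nat bijective for reasons of dimension. *)

Require Import Defs.
From mathcomp Require Import all_boot ssralg vector falgebra.

Local Open Scope ring_scope.
Import GRing.Theory.

Set Implicit Arguments.
Unset Strict Implicit.
Unset Printing Implicit Defensive.

Section Nondegeneracy.

Variables (k : fieldType) (A : falgType k) (S : bimod A).

Notation A_l := (regular_lmod A).

(** * Homomorphisms out of the regular module *)

Section OrbitHom.

Variables (M : lmod A) (m : M).

Fact orbit_hom_subproof :
  linear (fun a : A_l => lact (a : A) m) /\
  forall b (a : A_l), lact (lact b a : A) m = lact b (lact (a : A) m).
Proof.
have [ll _] := lact_bilin M; split=> [c u v|b a]; first exact: ll.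
by rewrite -lactM.
Qed.

Definition orbit_hom : homA A_l M :=
  mkhom (proj1 orbit_hom_subproof) (proj2 orbit_hom_subproof).

Lemma orbit_homE a : orbit_hom a = lact (a : A) m.
Proof. exact: mkhomE. Qed.

End OrbitHom.

Lemma hom_regularE (M : lmod A) (f : homA A_l M) : f = orbit_hom (f 1).
Proof.
by apply: homA_eqP => a; rewrite orbit_homE -homA_lact /= mulr1.
Qed.

Lemma regular_projective : projective A_l.
Proof.
move=> M N g f /(_ (f 1)) [x gx]; exists (orbit_hom x).
apply: homA_eqP => a.
by rewrite hcompE orbit_homE homA_lact gx -homA_lact /= mulr1.
Qed.

Definition regular_id : dual A_l := orbit_hom (1 : A_l).

Definition regular_proj : proj A := Proj regular_projective.

(** * Evaluation on [twist S P] and dual bases *)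

Section Evaluation.

Variable P : lmod A.

Definition twist_ev (d : dual P) : 'Hom(twist S P, S) :=
  tlift (X := bimod_right S) (Y := P) (fun (s : S) p => bract s (hfun d p : A)).

Lemma twist_evE d s p : twist_ev d (ptens s p) = bract s (hfun d p : A).
Proof.
have [rl rr] := bract_bilin S.
rewrite [LHS]tliftE //.
  by split=> w c u v; rewrite ?linearP ?rl ?rr.
by move=> t a q; rewrite homA_lact /= bractM.
Qed.

Lemma twist_ev_lact d a (z : twist S P) :
  twist_ev d (lact a z) = blact a (twist_ev d z).
Proof.
have [_ lr] := blact_bilin S; have [_ tr] := lact_bilin (twist S P).
elim/ptens_ind: z => [c u v IHu IHv|s p].
  by rewrite tr !linearP /= IHu IHv lr.
by rewrite lact_ptens !twist_evE blact_ract.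
Qed.

(** Scalars move across the tensor sign: s (x) d_i(p) e_i = s d_i(p) (x) e_i. *)
Lemma twist_dual_basis n (e : 'I_n -> P) (d : 'I_n -> dual P) :
    (forall p, p = \sum_i lact (hfun (d i) p : A) (e i)) ->
  forall z : twist S P, z = \sum_i ptens (twist_ev (d i) z) (e i).
Proof.
move=> dE; have [tl _] := ptens_bilin S P.
elim/ptens_ind => [c u v IHu IHv|s p].
  rewrite {1}IHu {1}IHv scaler_sumr -big_split /=; apply: eq_bigr => i _.
  by rewrite linearP tl.
rewrite {1}(dE p) (bilinr_sum _ _ _ (ptens_bilin S P)).
by apply: eq_bigr => i _; rewrite twist_evE ptens_balanced.
Qed.

End Evaluation.

(** Apply [f] to the expansion of p; thus the [d i] generate P^dagger as a right module. *)
Lemma dual_basis_dual (P : lmod A) n (e : 'I_n -> P) (d : 'I_n -> dual P) :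
    (forall p, p = \sum_i lact (hfun (d i) p : A) (e i)) ->
  forall f : dual P, f = \sum_i ract (d i) (hfun f (e i) : A).
Proof.
move=> dE f; apply: homA_eqP => p; rewrite /hfun linear_sum sum_lfunE /=.
rewrite -/(hfun f) {1}(dE p) linear_sum; apply: eq_bigr => i _.
rewrite -[RHS]/(hfun (dual_act (d i) (hfun f (e i))) p) dual_actE.
exact: (homA_lact f).
Qed.

(** * The trace of a central form and bijectivity of [natural_map l] *)

Section TraceOfForm.

Variable l : 'Hom(S, k^o).
Hypothesis lC : central l.

(** Since f o theta(d (x) m) = theta(d (x) f(m)), the trace is a plain contraction; centrality turns
    l(d(p) s) into l(s d(p)). *)
Lemma trace_pairing_theta (M : lmod A) (P : proj A) (f : homA M (twist S P))
    (d : dual P) (m : M) :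
  trace_pairing (trace_of l) f (theta_hom d m) = l (twist_ev d (f m)).
Proof.
have -> : trace_pairing (trace_of l) f (theta_hom d m)
    = HH0_form l (contr1 S d (f m)).
  rewrite /trace_pairing.
  have -> : hcomp f (theta_hom d m) = theta P (twist S P) (tens d (f m)).
    by apply: homA_eqP => p; rewrite hcompE thetaE !theta_homE homA_lact.
  rewrite [LHS]comp_lfunE universal_traceE; last exact: pmodP.
  congr (_ _); rewrite [LHS]tliftE //.
    exact: contr_bilin.
  exact: contr_balanced.
elim/ptens_ind: (f m) => [c u v IHu IHv|s p].
  by rewrite !linearP /= IHu IHv.
by rewrite contr1E HH0_formE // twist_evE lC.
Qed.

Lemma natural_map_inj_separated (M : lmod A) (P : proj A)
    (f : homA M (twist S P)) :
    injective (natural_map l) ->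
  (forall g, trace_pairing (trace_of l) f g = 0) -> f = 0.
Proof.
move=> inj f0; have [n [e [d dE]]] := dual_basis (@pmodP _ _ P).
have [tl _] := ptens_bilin S P.
apply: homA_eqP => m; rewrite [LHS](twist_dual_basis dE) big1 => [|i _].
  by rewrite /hfun linear0 zero_lfunE.
(* By linearity, l(a ev(f(m))) = l(ev(f(a m))) is the pairing of [f] with theta(d_i (x) a m). *)
have -> : twist_ev (d i) (f m) = 0.
  apply: inj; rewrite linear0; apply/lfunP => a.
  rewrite natural_mapE zero_lfunE -twist_ev_lact -homA_lact.
  by rewrite -trace_pairing_theta.
by rewrite -(addNr 0) -scaleN1r tl scaleN1r addNr.
Qed.

(* Sigma(P) is isomorphic to A^* (x)_A P, hence to the dual of P^dagger, so that
   Hom(M, Sigma(P)) is the full dual of Hom(P, M). *)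
Lemma trace_pairing_represents (M : lmod A) (P : proj A)
    (phi : 'Hom(homA P M, k^o)) :
    bijective (natural_map l) ->
  exists f, forall g, trace_pairing (trace_of l) f g = phi g.
Proof.
case=> r rK Kr; have [n [e [d dE]]] := dual_basis (@pmodP _ _ P).
have [tl _] := ptens_bilin S P; have [ll lr] := lact_bilin M.
have [_ hr] := theta_bilin P M.
(* Chosen so that, for x in P^dagger, the sum of the psi_i(m)(x(e_i)) is phi(theta(x (x) m)),
   because x is the sum of the d_i x(e_i). *)
pose psi i m : dual_bimod A :=
  linfun (fun a : A => phi (theta_hom (d i) (lact a m))) : 'Hom(A, k^o).
have psiE i m a :
    (psi i m : 'Hom(A, k^o)) a = phi (theta_hom (d i) (lact a m)).
  by rewrite [LHS]linfunE // => c u v; rewrite ll hr linearP.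
pose f0 (m : M) : twist S P := \sum_i ptens (r (psi i m)) (e i).
have inj : injective (natural_map l) := can_inj rK.
have f0l : linear f0.
  move=> c u v; rewrite scaler_sumr -big_split /=; apply: eq_bigr => i _.
  rewrite -tl; congr ptens; apply: inj; rewrite linearP /= !Kr.
  by apply/lfunP => a; rewrite add_lfunE scale_lfunE !psiE lr hr linearP.
have f0A a m : f0 (lact a m) = lact a (f0 m).
  rewrite lact_sumr; apply: eq_bigr => i _; rewrite lact_ptens.
  congr ptens; apply: inj; rewrite Kr; apply/lfunP => b.
  by rewrite psiE natural_mapE -blactM -natural_mapE Kr psiE lactM.
exists (mkhom f0l f0A) => g.
have [q _ qK] := theta_bij M (@pmodP _ _ P); rewrite -(qK g).
have pl : linear
    (fun h : homA P M => trace_pairing (trace_of l) (mkhom f0l f0A) h : k^o).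
  move=> c u v; rewrite /trace_pairing -linearP; congr (_ _).
  by apply: homA_eqP => p; rewrite !(hcompE, homA_linE) linearP.
elim/tens_ind: (q g) => [c u v IHu IHv|x m].
  by rewrite !linearP pl IHu IHv.
rewrite thetaE trace_pairing_theta mkhomE /f0 !linear_sum /=.
rewrite {2}(dual_basis_dual dE x) (bilinl_sum _ _ _ (theta_bilin P M)).
rewrite linear_sum.
apply: eq_bigr => i _.
by rewrite twist_evE lC -natural_mapE Kr psiE theta_balanced.
Qed.

Lemma natural_map_bij_nondegenerate :
  bijective (natural_map l) -> nondegenerate_trace (trace_of l).
Proof.
move=> bij M P; split=> [f|g g0].
  exact: (natural_map_inj_separated (bij_inj bij)).
rewrite (coord_vbasis (memvf g)) big1 // => i _.
(* Each coordinate form is represented by some [f], so it vanishes on the right radical. *)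
pose c : 'Hom(homA P M, k^o) :=
  linfun (fun h => coord (vbasis {:homA P M}) i h : k^o).
have [f fE] := trace_pairing_represents c bij.
have cE : c g = coord (vbasis {:homA P M}) i g.
  by rewrite [LHS]linfunE // => a u v; rewrite linearP.
by rewrite -cE -fE g0 scale0r.
Qed.

Lemma natural_map_blact a s :
  natural_map l (blact a s) = blact a (natural_map l s).
Proof.
by apply/lfunP => b; rewrite natural_mapE -blactM dual_lE natural_mapE.
Qed.

Lemma natural_map_bract s a :
  natural_map l (bract s a) = bract (natural_map l s) a.
Proof.
apply/lfunP => b.
by rewrite natural_mapE -blact_ract lC -blactM dual_rE natural_mapE.
Qed.

(** The second hypothesis embeds A into S^*, so dim A^* = dim A <= dim S^* = dim S; an injective map
    from S to A^* is then onto. *)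
Lemma natural_map_bij :
    (forall s, (forall a, l (blact a s) = 0) -> s = 0) ->
    (forall a, (forall s, l (blact a s) = 0) -> a = 0) ->
  bijective (natural_map l).
Proof.
have [ll lr] := blact_bilin S.
move=> Sinj Ainj.
pose tr (a : A) : 'Hom(S, k^o) := linfun (fun s => l (blact a s)).
have trE a s : tr a s = l (blact a s).
  by rewrite [LHS]linfunE // => c u v; rewrite lr linearP.
have trl : linear tr.
  move=> c u v; apply/lfunP => s.
  by rewrite add_lfunE scale_lfunE !trE ll linearP.
have injS : lker (natural_map l) == 0%VS.
  rewrite -subv0; apply/subvP => s; rewrite memv_ker memv0 => /eqP s0.
  by apply/eqP/Sinj => a; rewrite -natural_mapE s0 zero_lfunE.
have injA : lker (linfun tr) == 0%VS.
  rewrite -subv0; apply/subvP => a; rewrite memv_ker memv0 linfunE // => /eqP a0.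
  by apply/eqP/Ainj => s; rewrite -trE a0 zero_lfunE.
have dimlt (U V : vectType k) (h : 'Hom(U, V)) :
    lker h == 0%VS -> \dim {:U} <= \dim {:V}.
  move=> /eqP h0; rewrite -(limg_dim_eq (f := h) (U := fullv)) ?h0 ?capv0 //.
  exact/dimvS/subvf.
have dimdual (U : vectType k) : \dim {:'Hom(U, k^o)} = \dim {:U}.
  by rewrite !dimvf /dim /= muln1.
have onto : limg (natural_map l) = fullv.
  apply/eqP; rewrite -(geq_leqif (dimv_leqif_eq (subvf _))).
  rewrite limg_dim_eq ?(eqP injS) ?capv0 //.
  by rewrite [\dim _]dimdual -(dimdual S); apply: dimlt injA.
exists (natural_map l)^-1%VF => [s|f].
  exact: lker0_lfunK.
by rewrite limg_lfunVK // onto memvf.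
Qed.

End TraceOfForm.

(** * Recovering the form from a trace at the regular module *)

Definition regular_twist_hom (s : S) : homA A_l (twist S regular_proj) :=
  orbit_hom (M := twist S A_l) (ptens s (1 : A_l)).

Definition form_of_trace (t : twisted_trace S) : 'Hom(S, k^o) :=
  linfun (fun s => t regular_proj (regular_twist_hom s)).

Section FormOfTrace.

Variable t : twisted_trace S.

Lemma form_of_traceE s :
  form_of_trace t s = t regular_proj (regular_twist_hom s).
Proof.
have [tl _] := ptens_bilin S A_l; have [_ lr] := lact_bilin (twist S A_l).
rewrite [LHS]linfunE // => c u v; rewrite -linearP; congr (_ _).
by apply: homA_eqP => a; rewrite homA_linE !orbit_homE tl lr.
Qed.

Lemma form_of_trace_pairing (a : A) (s : S) :
  trace_pairing t (regular_twist_hom s) (orbit_hom (a : A_l))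
    = form_of_trace t (blact a s).
Proof.
rewrite form_of_traceE /trace_pairing; congr (_ _); apply: homA_eqP => b.
by rewrite hcompE !orbit_homE !lact_ptens -blactM.
Qed.

(** Cyclicity applied to right multiplication by [a] on A, whose twist sends s (x) 1 to s (x) a = s
    a (x) 1. *)
Lemma form_of_trace_central : central (form_of_trace t).
Proof.
move=> s a; rewrite -form_of_trace_pairing form_of_traceE.
rewrite [RHS](ttrC t (P := regular_proj) (Q := regular_proj)).
congr (_ _); apply: homA_eqP => b.
rewrite hcompE !orbit_homE !lact_ptens [RHS]twist_funE orbit_homE.
by rewrite -blact_ract ptens_balanced /= mul1r mulr1.
Qed.

Lemma ptens_regular (z : twist S A_l) : exists s, z = ptens s (1 : A_l).
Proof.
have [tl _] := ptens_bilin S A_l.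
elim/ptens_ind: z => [c _ _ [s ->] [s' ->]|s a].
  by exists (c *: s + s'); rewrite tl.
by exists (bract s (a : A)); rewrite ptens_balanced /= mulr1.
Qed.

Lemma ptens_regular_eq0 (s : S) : ptens s (1 : A_l) = 0 -> s = 0.
Proof.
move=> /(congr1 (twist_ev regular_id)).
by rewrite twist_evE orbit_homE /= mulr1 bract1 linear0.
Qed.

(** Identifying Hom(A, Sigma(A)) with Sigma and End(A) with A, the two radicals become those of (s,
    a) |-> l(a s), where l = [form_of_trace t]. *)
Lemma nondegenerate_bimod_iso :
    nondegenerate_pairing (@trace_pairing _ _ _ t regular_proj regular_proj) ->
  bimod_iso (natural_map (form_of_trace t)).
Proof.
case=> ndl ndr; have lC := form_of_trace_central; split.
- exact: natural_map_blact.
- exact: natural_map_bract.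
apply: natural_map_bij => [s s0|a a0].
  apply: ptens_regular_eq0.
  (* The tensor s (x) 1 is the value at 1 of [regular_twist_hom s]. *)
  rewrite -[LHS](lact1 (l := twist S A_l)) -[LHS](orbit_homE _ (1 : A_l)).
  rewrite -/(regular_twist_hom s).
  have -> : regular_twist_hom s = 0; last by rewrite /hfun linear0 zero_lfunE.
  by apply: ndl => g; rewrite (hom_regularE g) form_of_trace_pairing.
rewrite -[LHS](mul1r a) -[LHS](orbit_homE (a : A_l) 1).
have -> : orbit_hom (a : A_l) = 0; last by rewrite /hfun linear0 zero_lfunE.
apply: ndr => f.
have [s fs] := ptens_regular (hfun f (1 : A_l)).
by rewrite (hom_regularE f) fs form_of_trace_pairing.
Qed.

End FormOfTrace.

(** The identity of A is theta(id (x) 1), so [trace_pairing_theta] evaluates the trace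
    explicitly. *)
Lemma form_of_trace_of (l : 'Hom(S, k^o)) :
  central l -> form_of_trace (trace_of l) = l.
Proof.
move=> lC; apply/lfunP => s; rewrite -[s in LHS]blact1 -form_of_trace_pairing.
have -> : orbit_hom (1 : A_l) = theta_hom regular_id (1 : A_l).
  by apply: homA_eqP => a; rewrite theta_homE !orbit_homE /= !mulr1.
rewrite trace_pairing_theta // orbit_homE lact1.
by rewrite twist_evE orbit_homE /= mulr1 bract1.
Qed.

End Nondegeneracy.

Theorem theorem3p7 (k : fieldType) (A : falgType k) (Sigma : bimod A) :
  (forall lambda : 'Hom(Sigma, k^o), central lambda ->
      (nondegenerate_trace (trace_of lambda) <->
       (forall P Q : proj A,
           nondegenerate_pairing
             (fun (f : homA P (twist Sigma Q)) (g : homA Q P) =>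
                trace_pairing (trace_of lambda) f g)))
   /\ ((forall P Q : proj A,
           nondegenerate_pairing
             (fun (f : homA P (twist Sigma Q)) (g : homA Q P) =>
                trace_pairing (trace_of lambda) f g)) <->
       bimod_iso (natural_map lambda)))
  /\ ((exists t : twisted_trace Sigma, nondegenerate_trace t) ->
      exists phi : 'Hom(Sigma, dual_bimod A), bimod_iso phi).
Proof.
(* Stated for an arbitrary trace, this gives both (2) => (3) and the final existence claim. *)
have trace_iso (t : twisted_trace Sigma) :
    (forall P Q : proj A, nondegenerate_pairing (@trace_pairing _ _ _ t P Q)) ->
  bimod_iso (natural_map (form_of_trace t)).
  by move=> nd; apply: nondegenerate_bimod_iso.
split=> [l lC|[t nd]]; last first.
  by exists (natural_map (form_of_trace t)); apply: trace_iso => P Q; apply: nd.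
have iso_nd : bimod_iso (natural_map l) -> nondegenerate_trace (trace_of l).
  by case=> _ _; apply: natural_map_bij_nondegenerate.
have nd_iso := trace_iso (trace_of l); rewrite form_of_trace_of // in nd_iso.
split; split=> [nd|nd].
- by move=> P Q; apply: nd.
- exact/iso_nd/nd_iso.
- exact: nd_iso.
- by move=> P Q; apply: (iso_nd nd).
Qed.
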